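(* Let $P(z)=\sum_{m=0}^{N_P}p_mz^m$ be a polynomial of degree $N_P\ge1$ with real coefficients $p_m\ge0$, $p_{N_P}>0$, $p_0>0$, all of whose roots lie in the closed left half plane, i.e. $P(z)=p_{N_P}\prod_{j=1}^{N_P}(z+\eta_j)$ with $\operatorname{Re}\eta_j\ge0$. Let $X_P$ be a random variable with $\Pr\{X_P=m\}=p_m/P(1)$, $m=0,\dots,N_P$, and let $F_P(x)=\Pr\{(X_P-E[X_P])/\sqrt{\operatorname{Var}(X_P)}\le x\}$, $G(x)=(2\pi)^{-1/2}\int_{-\infty}^xe^{-u^2/2}du$. Then $$\sup_{x\in\mathbb{R}}|F_P(x)-G(x)|\le\frac{12}{\sqrt{\operatorname{Var}(X_P)}}.$$ Consequently, if $\mathcal{P}$ is a family of such polynomials, of unbounded degrees, in which $\operatorname{Var}(X_P)\to\infty$ as $N_P\to\infty$, then $\sup_{x}|F_P(x)-G(x)|\to0$ as $N_P\to\infty$ in $\mathcal{P}$. *)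

(* Defs.v *)
From HB Require Import structures.
From mathcomp Require Import all_boot all_order all_algebra.
From mathcomp Require Import all_classical all_reals all_analysis.
From mathcomp Require Import complex.

Set Implicit Arguments.
Unset Strict Implicit.
Unset Printing Implicit Defensive.

Import Order.TTheory GRing.Theory Num.Theory.
Import numFieldNormedType.Exports.

Local Open Scope classical_set_scope.
Local Open Scope ring_scope.

Definition deg (R : realType) (P : {poly R}) : nat := (size P).-1.

Definition left_half_plane_poly (R : realType) (P : {poly R}) : Prop :=
  [/\ (1 <= deg P)%N,
      forall m : nat, 0 <= P`_m,
      0 < P`_(deg P),
      0 < P`_0 &
      forall z : R[i], root (map_poly (real_complex R) P) z ->
        complex.Re z <= 0].

Definition has_poly_law (R : realType) (P : {poly R}) (d : measure_display)
    (T : measurableType d) (Pr : probability T R) (X : {RV Pr >-> R}) : Prop :=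
  forall m : nat, (m <= deg P)%N ->
    Pr [set w | X w = m%:R] = (P`_m / P.[1])%:E.

Definition std_cdf (R : realType) (d : measure_display) (T : measurableType d)
    (Pr : probability T R) (X : {RV Pr >-> R}) (x : R) : \bar R :=
  Pr [set w | (X w - fine 'E_Pr[X]) / Num.sqrt (fine 'V_Pr[X]) <= x].

Definition gauss_cdf (R : realType) (x : R) : \bar R :=
  ((Num.sqrt (2 * pi))^-1%:E *
   \int[lebesgue_measure]_(u in `]-oo, x]) (expR (- (u ^+ 2 / 2)))%:E)%E.

Definition gauss_dist (R : realType) (d : measure_display)
    (T : measurableType d) (Pr : probability T R) (X : {RV Pr >-> R}) : \bar R :=
  ereal_sup (range (fun x : R => `|std_cdf X x - gauss_cdf x|%E)).

(* The filter "deg (P i) tends to infinity" on the index type of a family. *)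
Definition deg_infty (R : realType) (I : Type) (P : I -> {poly R}) :
    set_system I :=
  filter_from [set: nat] (fun n => [set i | (n <= deg (P i))%N]).

(* Main.v *)
Require Import Defs.
From HB Require Import structures.
From mathcomp Require Import all_boot all_order all_algebra.
From mathcomp Require Import all_classical all_reals all_analysis.
From mathcomp Require Import measurable_realfun complex ring lra zify.

Set Implicit Arguments.
Unset Strict Implicit.
Unset Printing Implicit Defensive.

Import Order.TTheory GRing.Theory Num.Theory.
Import numFieldNormedType.Exports.

Local Open Scope classical_set_scope.
Local Open Scope ring_scope.

(* Conjugate roots pair up, so [P] is a product of polynomials of degree at most
   two with nonnegative coefficients: [X_P] is a sum of independent variables
   with values in {0, 1, 2}. Stein's method with the zero-bias coupling then
   gives the bound. Replacing one summand by its zero-bias transform moves the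
   standardised sum [W] by at most [2 / sigma], and
   [E (W f (W)) = E (f' (W^* ))]; for the solution [f] of
   [f' (w) - w f (w) = 1(w <= y) - Phi y] this reads
   [P (W^* <= y) - Phi y = E (W f (W) - W^* f (W^* ))], which is at most
   [4 * (2 / sigma)] because [f] and [f'] are bounded by 2. Comparing
   [W^* <= y] with [W <= x] costs a shift of [2 / sigma] in [Phi], hence the
   constant 10 <= 12. Taking [y] on the lattice of values of [W] replaces the
   integral against the uniform component of [W^*] by the mean value theorem. *)

(** * Laws given by polynomial coefficients *)

Section coefficient_law.
Variable R : realType.
Implicit Types (P Q : {poly R}) (g h : nat -> R).

(** Left unnormalised so that it is linear in [P]; identities about products of polynomials then
    reduce to monomials. *)
Definition coef_sum g P : R := \sum_(i < size P) P`_i * g i.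

Lemma coef_sum_widen n P g : (size P <= n)%N ->
  coef_sum g P = \sum_(i < n) P`_i * g i.
Proof.
move=> sPn; rewrite /coef_sum (big_ord_widen n (fun i => P`_i * g i))//.
rewrite big_mkcond/=; apply: eq_bigr => i _; case: ifPn => //.
by rewrite -leqNgt => /leq_sizeP -> //; rewrite mul0r.
Qed.

Lemma coef_sum_is_linear g : linear (coef_sum g).
Proof.
move=> c P Q; set n := maxn (size P) (size Q).
have sn : (size (c *: P + Q)%R <= n)%N.
  rewrite (leq_trans (size_polyD _ _))// /n geq_max leq_maxr andbT.
  by rewrite (leq_trans (size_scale_leq _ _))// leq_maxl.
rewrite (coef_sum_widen _ sn) !(@coef_sum_widen n) ?leq_maxl ?leq_maxr//.
rewrite scaler_sumr -big_split/=; apply: eq_bigr => i _.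
by rewrite coefD coefZ mulrDl -mulrA.
Qed.

HB.instance Definition _ g :=
  GRing.isLinear.Build R {poly R} R _ (coef_sum g) (coef_sum_is_linear g).

Lemma coef_sumXn k g : coef_sum g 'X^k = g k.
Proof.
rewrite /coef_sum size_polyXn big_ord_recr/= coefXn eqxx mul1r big1 ?add0r// => i _.
by rewrite coefXn ltn_eqF// mul0r.
Qed.

Lemma coef_sumM P Q g :
  coef_sum g (P * Q) = coef_sum (fun i => coef_sum (fun j => g (i + j)%N) Q) P.
Proof.
rewrite -{1}[P]coefK -{1}[Q]coefK !poly_def mulr_suml (raddf_sum (coef_sum g)).
apply: eq_bigr => i _; rewrite mulr_sumr (raddf_sum (coef_sum g))/= /coef_sum.
rewrite mulr_sumr; apply: eq_bigr => j _.
by rewrite -scalerAl -scalerAr -exprD -!/(coef_sum _ _) !linearZ/= coef_sumXn.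
Qed.

Lemma coef_sum1 P : coef_sum (fun=> 1) P = P.[1].
Proof.
by rewrite horner_coef; apply: eq_bigr => i _; rewrite expr1n.
Qed.

Lemma coef_sumD g h P : coef_sum (g \+ h) P = coef_sum g P + coef_sum h P.
Proof. by rewrite -big_split; apply: eq_bigr => i _; rewrite mulrDr. Qed.

Lemma coef_sumZ P c g : coef_sum (fun n => c * g n) P = c * coef_sum g P.
Proof. by rewrite mulr_sumr; apply: eq_bigr => i _; rewrite mulrCA. Qed.

Definition coef_law P g : R := coef_sum g P / P.[1].

(** Multiplying polynomials convolves their laws: a product corresponds to a sum of independent
    variables. *)
Lemma coef_lawM P Q g :
  coef_law (P * Q) g = coef_law P (fun i => coef_law Q (fun j => g (i + j)%N)).
Proof.
rewrite /coef_law coef_sumM hornerM invfM mulrCA [RHS]mulrC; congr (_ * _).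
by rewrite mulrC -coef_sumZ; congr (coef_sum _ P); apply/funext => i;
  rewrite mulrC.
Qed.

Lemma coef_lawD P g h : coef_law P (fun n => g n + h n) = coef_law P g + coef_law P h.
Proof. by rewrite /coef_law (coef_sumD g h P) mulrDl. Qed.

Lemma coef_lawZ P c g : coef_law P (fun n => c * g n) = c * coef_law P g.
Proof. by rewrite /coef_law coef_sumZ mulrA. Qed.

Lemma coef_law_exchange P Q (F : nat -> nat -> R) :
  coef_law Q (fun q => coef_law P (F^~ q)) =
  coef_law P (fun p => coef_law Q (F p)).
Proof.
rewrite /coef_law /coef_sum !mulr_suml.
under eq_bigr do rewrite !mulr_suml mulr_sumr mulr_suml.
under [RHS]eq_bigr do rewrite !mulr_suml mulr_sumr mulr_suml.
by rewrite exchange_big/=; apply: eq_bigr => i _; apply: eq_bigr => j _; ring.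
Qed.

Lemma coef_law_cst P c : P.[1] != 0 -> coef_law P (fun=> c) = c.
Proof.
move=> P1; have -> : (fun=> c) = (fun _ : nat => c * 1) by rewrite mulr1.
by rewrite coef_lawZ /coef_law coef_sum1 divff// mulr1.
Qed.

Lemma coef_law_le P g h : (forall i, 0 <= P`_i) -> 0 < P.[1] ->
  (forall i, g i <= h i) -> coef_law P g <= coef_law P h.
Proof.
move=> P0 P1 gh; rewrite /coef_law ler_pM2r ?invr_gt0//.
by apply: ler_sum => i _; rewrite ler_wpM2l.
Qed.

End coefficient_law.

(** * Zero-bias couplings for polynomials with roots in the left half plane *)

Section stein_coupling.
Variable R : realType.
Implicit Types (P Q : {poly R}).

(* [L] integrates against [v] times a coupling of the law of [P], in the first
   coordinate, with an integer [b] such that [b + U], [U] uniform on [0, 1],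
   follows the zero-bias transform of that law; the coupling lives on
   [n - 2 <= b < b + 1 <= n + 2]. *)
Definition zero_bias_coupling P (mu v : R) (L : (nat -> nat -> R) -> R) :=
  [/\ forall h k, (forall n b, (n <= b + 2)%N -> (b <= n + 1)%N ->
        h n b <= k n b) -> L h <= L k,
      forall g, L (fun n _ => g n) = v * coef_law P g &
      forall f, L (fun _ b => f b.+1 - f b) =
        coef_law P (fun n => (n%:R - mu) * f n)].

(** [mu] and [v] stay existential so that products need no computation of moments;
    [zero_bias_moments] identifies them afterwards. *)
Definition zero_biased P :=
  [/\ forall i, 0 <= P`_i, 0 < P.[1] &
      exists mu v L, zero_bias_coupling P mu v L].

(** The zero-bias transform of an independent sum replaces one summand, drawn with probability
    proportional to its variance, by its own transform. As [LP] and [LQ] carry the weights [vP] and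
    [vQ], this mixture is a plain sum; the window linking [n] and [b] survives translation. *)
Lemma zero_biasedM P Q : zero_biased P -> zero_biased Q -> zero_biased (P * Q).
Proof.
move=> [P0 P1 [mP [vP [LP [monoP margP biasP]]]]].
move=> [Q0 Q1 [mQ [vQ [LQ [monoQ margQ biasQ]]]]].
split.
- by move=> i; rewrite coefM sumr_ge0// => j _; rewrite mulr_ge0.
- by rewrite hornerM mulr_gt0.
exists (mP + mQ), (vP + vQ), (fun h =>
  coef_law Q (fun q => LP (fun n b => h (n + q)%N (b + q)%N)) +
  coef_law P (fun p => LQ (fun n b => h (p + n)%N (p + b)%N))); split.
- move=> h k hk; apply: lerD; apply: coef_law_le => // i.
    by apply: monoP => n b nb bn; apply: hk; lia.
  by apply: monoQ => n b nb bn; apply: hk; lia.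
- move=> g; rewrite mulrDl.
  under [X in coef_law Q X]funext do rewrite (margP (fun n => g (n + _)%N)).
  under [X in coef_law P X]funext do rewrite (margQ (fun n => g (_ + n)%N)).
  by rewrite !coef_lawZ coef_law_exchange -coef_lawM.
- move=> f.
  have EQ p : LQ (fun _ b => f (p + b).+1 - f (p + b)%N) =
      coef_law Q (fun n => (n%:R - mQ) * f (p + n)%N).
    rewrite -(biasQ (fun n => f (p + n)%N)).
    by congr LQ; apply/funext => _; apply/funext => b; rewrite addnS.
  under [X in coef_law Q X]funext do rewrite (biasP (fun n => f (n + _)%N)).
  under [X in coef_law P X]funext do rewrite EQ.
  rewrite (coef_law_exchange P Q (fun p q => (p%:R - mP) * f (p + q)%N)).
  rewrite -coef_lawD coef_lawM; congr coef_law; apply/funext => p.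
  rewrite -coef_lawD; congr coef_law; apply/funext => q.
  by rewrite natrD; ring.
Qed.

(** On [{0, 1, 2}] the transform has constant density on [[0, 1]] and on [[1, 2]]. Taking [b] in
    [{0, 1}] independent of [n] is enough: every such pair lies in the window, which is where its
    width comes from. *)
Lemma zero_biased_size3 P : (size P <= 3)%N -> (forall i, 0 <= P`_i) ->
  0 < P.[1] -> zero_biased P.
Proof.
move=> sP P0 P1; split => //.
have lawE g : coef_law P g =
    (P`_0 * g 0%N + P`_1 * g 1%N + P`_2 * g 2%N) / P.[1].
  by rewrite /coef_law (coef_sum_widen _ sP) !big_ord_recl big_ord0/= addr0 addrA.
have P1E : P.[1] = P`_0 + P`_1 + P`_2.
  by rewrite -coef_sum1 (coef_sum_widen _ sP) !big_ord_recl big_ord0/=; ring.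
have P10 : P`_0 + P`_1 + P`_2 != 0 by rewrite -P1E gt_eqF.
pose mu := (P`_1 + 2 * P`_2) / P.[1].
have mu0 : 0 <= mu by rewrite divr_ge0 ?addr_ge0 ?mulr_ge0// ltW.
have mu2 : mu <= 2.
  by rewrite ler_pdivrMr// P1E; have := P0 0%N; have := P0 1%N; lra.
(* Summation by parts: with [p_n] the mass at [n] and [mu] the mean, the weights [(n - mu) p_n] sum
   to zero, so their pairing with [f] is [a0 (f 1 - f 0) + a1 (f 2 - f 1)]. *)
pose a0 := mu * (P`_0 / P.[1]); pose a1 := (2 - mu) * (P`_2 / P.[1]).
have a0_ge0 : 0 <= a0 by apply: mulr_ge0 => //; rewrite divr_ge0// ltW.
have a1_ge0 : 0 <= a1 by apply: mulr_ge0; rewrite ?subr_ge0// divr_ge0// ltW.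
exists mu, (a0 + a1),
  (fun h => coef_law P (fun n => a0 * h n 0%N + a1 * h n 1%N)); split.
- move=> h k hk; rewrite !lawE ler_pM2r ?invr_gt0//.
  by rewrite !lerD// ler_wpM2l// lerD// ler_wpM2l// hk.
- move=> g; rewrite -coef_lawZ; congr coef_law; apply/funext => n; ring.
- move=> f; rewrite coef_law_cst ?gt_eqF// lawE /a0 /a1 /mu P1E; field.
  by rewrite P10.
Qed.

(** Strong induction on the size, splitting off a linear factor for a real root and a real quadratic
    one for a conjugate pair; [Re z <= 0] makes the coefficients of these factors nonnegative. *)
Lemma zero_biased_left_half_plane P : 0 < lead_coef P ->
  (forall z : R[i], root (map_poly (real_complex R) P) z ->
    complex.Re z <= 0) ->
  zero_biased P.
Proof.
have [n] := ubnP (size P); elim: n P => // n IH P /ltnSE sPn lP rP.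
have P0 : P != 0 by rewrite -lead_coef_eq0 gt_eqF.
have [sP|sP] := leqP (size P) 1.
  have PE := size1_polyC sP;
    have c0 : 0 < P`_0 by rewrite PE lead_coefC coefC in lP *.
  apply: zero_biased_size3; first exact: leq_trans sP _.
    by move=> i; rewrite PE coefC; case: ifP => // _; rewrite ltW.
  by rewrite PE hornerC.
have IHQ (Q S : {poly R}) : (1 < size S)%N -> P = Q * S -> 0 < lead_coef S ->
    zero_biased S -> zero_biased P.
  move=> sS PQS lS zS; rewrite PQS; apply: zero_biasedM zS.
  have Q0 : Q != 0 by apply: contraNneq P0 => Q0; rewrite PQS Q0 mul0r.
  have S0 : S != 0 by rewrite -lead_coef_eq0 gt_eqF.
  apply: IH.
  - move: sPn; rewrite PQS size_mul//; move: sS.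
    by case: (size S) => [|[|m]]// _; rewrite !addnS/=; apply: leq_trans;
      rewrite ltnS leq_addr.
  - by move: lP; rewrite PQS lead_coefM pmulr_lgt0.
  - move=> z Qz; apply: rP; rewrite PQS rmorphM rootM Qz//.
have [z rz] : exists z, root (map_poly (real_complex R) P) z.
  apply/closed_rootP; rewrite size_map_poly; apply: contraTneq sP => ->//.
have rez := rP _ rz.
have [imz|imz] := eqVneq (complex.Im z) 0.
  have zE : z = real_complex R (complex.Re z) by case: z imz {rz rez} => a b /= ->.
  move: rz; rewrite zE fmorph_root => /factor_theorem[Q PQ].
  apply: (IHQ Q _ _ PQ); rewrite ?size_XsubC ?lead_coefXsubC//.
  apply: zero_biased_size3; rewrite ?size_XsubC//.
    move=> i; rewrite coefB coefX coefC; case: i => [|[|i]]//=;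
      rewrite ?sub0r ?subr0 ?oppr_ge0//.
  by rewrite hornerXsubC; lra.
pose zc := (z^*)%C.
have zzc : z != zc.
  by rewrite /zc; case: (z) imz => a b /= b0; rewrite eq_complex/= eqxx/=;
    apply: contra b0 => /eqP; lra.
have rzc : root (map_poly (real_complex R) P) zc.
  rewrite /zc -complex_root_conj -map_poly_comp/=
    (_ : map_poly _ P = map_poly (real_complex R) P)//.
  by apply: eq_map_poly => x; exact: conjc_real.
pose S : {poly R} := 'X^2 - (2 * complex.Re z)%:P * 'X +
  (complex.Re z ^+ 2 + complex.Im z ^+ 2)%:P.
have SE : map_poly (real_complex R) S = ('X - z%:P) * ('X - zc%:P).
  transitivity ('X^2 - (z + zc)%:P * 'X + (z * zc)%:P); last first.
    by rewrite polyCD polyCM; ring.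
  rewrite /S rmorphD rmorphB/= map_polyXn rmorphM/= map_polyX !map_polyC/=.
  rewrite addcJ -sqr_normc -add_Re2_Im2 rmorphM/=.
  by rewrite (_ : real_complex R 2 = 2)// (rmorph_nat (real_complex R) 2).
(* Divisibility over [R[i]] descends to [R]; the two linear factors are coprime since [z] is not
   real. *)
have dS : S %| P.
  rewrite -(dvdp_map (real_complex R)) SE Gauss_dvdp; last first.
    by rewrite coprimep_XsubC root_XsubC eq_sym.
  by rewrite !dvdp_XsubCl rz rzc.
have sS : size S = 3%N.
  by rewrite -(size_map_poly (real_complex R)) SE size_mul ?polyXsubC_eq0 ?size_XsubC.
have [Q PQ] := dvdpP _ _ dS.
have S2 : S`_2 = 1.
  by rewrite /S !coefD coefN coefCM coefXn coefX coefC/= mulr0; ring.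
have S1 : S`_1 = - (2 * complex.Re z).
  by rewrite /S !coefD coefN coefCM coefXn coefX coefC/= mulr1; ring.
have S0 : S`_0 = complex.Re z ^+ 2 + complex.Im z ^+ 2.
  by rewrite /S !coefD coefN coefCM coefXn coefX coefC/= mulr0; ring.
have S_ge0 i : 0 <= S`_i.
  case: i => [|[|[|i]]].
  - by rewrite S0 addr_ge0 ?sqr_ge0.
  - by rewrite S1; lra.
  - by rewrite S2.
  - by rewrite nth_default// sS.
apply: (IHQ Q S); rewrite ?sS//; first by rewrite lead_coefE sS S2.
apply: zero_biased_size3; rewrite ?sS//.
rewrite -coef_sum1 /coef_sum sS !big_ord_recl big_ord0/= S2.
by rewrite !mulr1 addr0; have := S_ge0 0%N; have := S_ge0 1%N; lra.
Qed.

End stein_coupling.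

(** * The Gaussian distribution function *)

Section gaussian_cdf.
Variable R : realType.
Local Notation mu := (@lebesgue_measure R).

Definition gauss_pdf (x : R) : R := expR (- (x ^+ 2 / 2)) / Num.sqrt (2 * pi).

Definition gauss_cdfr (x : R) : R := fine (gauss_cdf x).

Lemma gauss_pdfE : gauss_pdf = normal_pdf 0 1.
Proof.
apply/funext => x; rewrite normal_pdfE ?oner_eq0// /gauss_pdf mulrC.
by rewrite /normal_peak /normal_fun subr0 !expr1n mul1r mulNr mulr_natl.
Qed.

Lemma gauss_cdf_normal_prob x :
  gauss_cdf x = normal_prob 0 1 (`]-oo, x]%classic : set (measurableTypeR R)).
Proof.
rewrite /gauss_cdf /normal_prob -gauss_pdfE -ge0_integralZl//=.
- by apply: eq_integral => u _; rewrite -EFinM mulrC.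
- apply/measurable_EFinP; apply/measurable_funTS/measurableT_comp => //.
  by apply: measurableT_comp => //; apply: measurable_funM => //;
    exact: measurable_funX.
Qed.

Lemma gauss_cdf_fin x : gauss_cdf x = (gauss_cdfr x)%:E.
Proof. by rewrite /gauss_cdfr gauss_cdf_normal_prob fineK// fin_num_measure. Qed.

Lemma gauss_cdfr_ge0 x : 0 <= gauss_cdfr x.
Proof. by rewrite -lee_fin -gauss_cdf_fin gauss_cdf_normal_prob measure_ge0. Qed.

Lemma gauss_cdfr_le1 x : gauss_cdfr x <= 1.
Proof. by rewrite -lee_fin -gauss_cdf_fin gauss_cdf_normal_prob probability_le1. Qed.

Lemma gauss_cdfr_le x y : x <= y -> gauss_cdfr x <= gauss_cdfr y.
Proof.
move=> xy; rewrite -lee_fin -!gauss_cdf_fin !gauss_cdf_normal_prob.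
by apply: le_measure; rewrite ?inE//; apply: subitvPr.
Qed.

Lemma is_derive_gauss_cdfr (x : R) : is_derive x 1 gauss_cdfr (gauss_pdf x).
Proof.
(* The right end [x + 1] leaves [x] in the interior, where the fundamental theorem of calculus
   applies. *)
have int : mu.-integrable `]-oo, (x + 1)%R] (EFin \o gauss_pdf).
  rewrite gauss_pdfE; apply: (integrableS measurableT) => //.
  exact: integrable_normal_pdf.
have cont : {for x, continuous gauss_pdf}.
  by rewrite gauss_pdfE; apply: continuous_normal_pdf; rewrite oner_eq0.
have xx : x < x + 1 by rewrite ltrDl.
have [der val] := continuous_FTC1 xx int (ltNyr _) cont.
have E : gauss_cdfr = fun y => \int[mu]_(t in [set` `]-oo, y]]) gauss_pdf t.
  apply/funext => y; rewrite /gauss_cdfr gauss_cdf_normal_prob /normal_prob.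
  by rewrite -gauss_pdfE.
by rewrite E; apply: DeriveDef; [exact: der|rewrite -derive1E; exact: val].
Qed.

(** The identity as a random variable under the normal law: its [cdf] is the Gaussian one, so the
    general limits of a [cdf] at infinity apply. *)
Let idTR : measurableTypeR R -> R := idfun.

#[local] HB.instance Definition _ :=
  @isMeasurableFun.Build _ _ _ _ idTR (@measurable_id _ _ setT).

Lemma gauss_cdfr_cvgy : gauss_cdfr x @[x --> +oo] --> (1 : R).
Proof.
have := cvg_cdfy1 (idTR : {RV (normal_prob 0 1 : probability _ R) >-> R}).
rewrite (_ : cdf _ = fun x => (gauss_cdfr x)%:E); last first.
  by apply/funext => x; rewrite -gauss_cdf_fin gauss_cdf_normal_prob.
by move/fine_cvgP => -[_].
Qed.

Lemma gauss_cdfr_cvgNy : gauss_cdfr x @[x --> -oo] --> (0 : R).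
Proof.
have := cvg_cdfNy0 (idTR : {RV (normal_prob 0 1 : probability _ R) >-> R}).
rewrite (_ : cdf _ = fun x => (gauss_cdfr x)%:E); last first.
  by apply/funext => x; rewrite -gauss_cdf_fin gauss_cdf_normal_prob.
by move/fine_cvgP => -[_].
Qed.

Lemma sqrt_2pi_ge2 : 2 <= Num.sqrt (2 * pi) :> R.
Proof.
rewrite -[leLHS](@ger0_norm R)// -sqrtr_sqr ler_wsqrtr//.
by have := @pi_ge2 R; lra.
Qed.

Lemma sqrt_2pi_le4 : Num.sqrt (2 * pi) <= 4 :> R.
Proof.
rewrite -[leRHS](@ger0_norm R)// -sqrtr_sqr ler_wsqrtr//.
by have := @pihalf_lt2 R; lra.
Qed.

Lemma gauss_pdf_gt0 x : 0 < gauss_pdf x.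
Proof. by rewrite divr_gt0 ?expR_gt0//; have := sqrt_2pi_ge2; lra. Qed.

Lemma gauss_pdf_le1 x : gauss_pdf x <= 1.
Proof.
have s2 := sqrt_2pi_ge2.
rewrite ler_pdivrMr ?mul1r; last by lra.
apply: (@le_trans _ _ 1); last by lra.
by rewrite -expR0 ler_expR oppr_le0 divr_ge0 ?sqr_ge0.
Qed.

Lemma gauss_pdf_ge x : `|x| <= 1 -> 8^-1 <= gauss_pdf x.
Proof.
move=> x1; have s2 := sqrt_2pi_ge2; have s4 := sqrt_2pi_le4.
rewrite ler_pdivlMr; last by lra.
apply: (@le_trans _ _ 2^-1); first by lra.
apply: (@le_trans _ _ (1 + - (x ^+ 2 / 2))); last exact: expR_ge1Dx.
have : x ^+ 2 <= 1 by rewrite -real_normK ?num_real// expr_le1.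
lra.
Qed.

Lemma gauss_pdfN x : gauss_pdf (- x) = gauss_pdf x.
Proof. by rewrite /gauss_pdf sqrrN. Qed.

Lemma is_derive_gauss_pdf (x : R) : is_derive x 1 gauss_pdf (- x * gauss_pdf x).
Proof.
pose c := (Num.sqrt (2 * pi : R))^-1.
have -> : gauss_pdf = c \*: (expR \o (fun x => - (2^-1 * x ^+ 2))).
  by apply/funext => y; rewrite /gauss_pdf mulrC [_ / 2]mulrC.
have dE : is_derive x 1 (fun y : R => - (2^-1 * y ^+ 2)) (- x).
  have := is_deriveN (is_deriveZ 2^-1 (is_deriveX 2 (is_derive_id x 1))).
  by move/is_derive_eq; apply; rewrite /GRing.scale/= expr1 mulr1 mulKf.
have := is_deriveZ c (@is_derive1_comp R expR _ x _ _ (is_derive_expR _) dE).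
move/is_derive_eq; apply.
rewrite -[LHS]/(c * (expR (- (2^-1 * x ^+ 2)) * - x)).
by rewrite -[RHS]/(- x * (c * expR (- (2^-1 * x ^+ 2)))); ring.
Qed.

Lemma is_derive_MVT (f df : R -> R) (a b : R) : a < b ->
  (forall x : R, a <= x <= b -> is_derive x 1 f (df x)) ->
  exists2 c, a < c < b & f b - f a = df c * (b - a).
Proof.
move=> ab fdf.
have cf : {within `[a, b], continuous f}.
  apply: continuous_in_subspaceT => x; rewrite inE/= in_itv/= => xab.
  by apply/differentiable_continuous/derivable1_diffP; have [] := fdf x xab.
have dfab (x : R) : x \in `]a, b[ -> is_derive x 1 f (df x).
  by rewrite in_itv/= => /andP[ax xb]; apply: fdf; rewrite !ltW.
have [c cab E] := MVT ab dfab cf.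
by exists c => //; move: cab; rewrite in_itv.
Qed.

Lemma gauss_cdfr_lipschitz a b : a <= b -> gauss_cdfr b - gauss_cdfr a <= b - a.
Proof.
rewrite le_eqVlt => /predU1P[->|ab]; first by rewrite !subrr.
have [c _ ->] := is_derive_MVT ab (fun x _ => is_derive_gauss_cdfr x).
by rewrite ler_piMl ?gauss_pdf_le1// subr_ge0 ltW.
Qed.

(** The Mills ratio bound: [gauss_pdf y / y - T y] has derivative [- gauss_pdf y / y^2], so it
    decreases, and at a far point [t] it is at least [- T t], which is small. An abstract [T] serves
    both tails. *)
Lemma mills (T : R -> R) (x : R) : (forall x, 0 <= T x) ->
  (forall x : R, is_derive x 1 T (- gauss_pdf x)) ->
  T t @[t --> +oo] --> (0 : R) -> 0 < x -> x * T x <= gauss_pdf x.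
Proof.
move=> T0 dT Ty x0.
rewrite mulrC -ler_pdivlMr//; apply/ler_addgt0Pl => e e0.
have [t [xt Te]] : exists t, x < t /\ T t < e.
  have /cvgrPdist_lt/(_ _ e0) He := Ty.
  near (pinfty_nbhs R) => t; exists t; split; near: t;
    first by apply: nbhs_pinfty_gt; rewrite num_real.
  by apply: filterS He => u; rewrite sub0r normrN ger0_norm.
pose h (y : R) := gauss_pdf y / y - T y.
have dh (y : R) : x <= y <= t ->
    is_derive y 1 h (- gauss_pdf y - gauss_pdf y / y ^+ 2 + gauss_pdf y).
  move=> /andP[xy _]; have y0 : y != 0 by rewrite gt_eqF// (lt_le_trans x0).
  have := is_deriveB (is_deriveM (is_derive_gauss_pdf y)
    (is_deriveV y0 (is_derive_id y 1))) (dT y).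
  by move/is_derive_eq; apply; rewrite /GRing.scale/=; field.
have [c /andP[xc _] hE] := is_derive_MVT xt dh.
have : h t - h x <= 0.
  rewrite hE addrAC addNr add0r mulNr oppr_le0 mulr_ge0//;
    last by rewrite subr_ge0 ltW.
  by rewrite divr_ge0 ?sqr_ge0// ltW// gauss_pdf_gt0.
have : 0 <= gauss_pdf t / t by rewrite divr_ge0 ?ltW// ?gauss_pdf_gt0// (lt_trans x0).
by rewrite /h; lra.
Unshelve. all: by end_near. Qed.

Lemma mills_right x : 0 < x -> x * (1 - gauss_cdfr x) <= gauss_pdf x.
Proof.
apply: (mills (T := fun x => 1 - gauss_cdfr x)).
- by move=> y; rewrite subr_ge0 gauss_cdfr_le1.
- move=> y; have := is_deriveB (is_derive_cst (1:R) y 1) (is_derive_gauss_cdfr y).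
  by move/is_derive_eq; apply; rewrite sub0r.
- rewrite -[X in _ --> X](subrr 1); apply: cvgB; first exact: cvg_cst.
  exact: gauss_cdfr_cvgy.
Qed.

Lemma mills_left x : x < 0 -> - x * gauss_cdfr x <= gauss_pdf x.
Proof.
move=> x0; rewrite -(gauss_pdfN x) -{2}(opprK x).
apply: (mills (T := gauss_cdfr \o -%R)); last by rewrite oppr_gt0.
- by move=> y; exact: gauss_cdfr_ge0.
- move=> y; have := is_derive1_comp (is_derive_gauss_cdfr (- y)) (is_deriveNid y 1).
  by move/is_derive_eq; apply; rewrite gauss_pdfN mulrN1.
- by apply/cvgNy_compNP; exact: gauss_cdfr_cvgNy.
Qed.

End gaussian_cdf.

(** * The solution of Stein's equation *)

Section stein_solution.
Variables (R : realType) (y : R).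
Local Notation Phi := (@gauss_cdfr R).
Local Notation phi := (@gauss_pdf R).

(** The bounded solution of [f' w - w f w = 1(w <= y) - Phi y] in closed form; its derivative jumps
    at [y]. *)
Definition stein_sol (w : R) : R :=
  if w <= y then Phi w * (1 - Phi y) / phi w else Phi y * (1 - Phi w) / phi w.

Lemma stein_sol_left w : w <= y -> stein_sol w = Phi w * (1 - Phi y) / phi w.
Proof. by rewrite /stein_sol => ->. Qed.

Lemma stein_sol_right w : y <= w -> stein_sol w = Phi y * (1 - Phi w) / phi w.
Proof.
rewrite le_eqVlt => /predU1P[<-|yw]; first by rewrite stein_sol_left.
by rewrite /stein_sol leNgt yw.
Qed.

Let is_derive_ratio (p : R -> R) (dp w : R) : is_derive w 1 p dp ->
  is_derive w 1 (fun u => p u / phi u) (dp / phi w + w * (p w / phi w)).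
Proof.
move=> dpw; have phi0 : phi w != 0 by rewrite gt_eqF// gauss_pdf_gt0.
have := is_deriveM dpw (is_deriveV phi0 (is_derive_gauss_pdf w)).
by move/is_derive_eq; apply; rewrite /GRing.scale/=; field.
Qed.

(** Stein's equation in mean value form. The kink [y] is kept out of the interior of the interval,
    where the indicator is then constant and equal to its value at [b]. *)
Lemma stein_sol_increment a b : a < b -> (b <= y) || (y <= a) ->
  exists2 xi, a < xi < b & stein_sol b - stein_sol a =
    (xi * stein_sol xi + (b <= y)%R%:R - Phi y) * (b - a).
Proof.
move=> ab.
have phi0 w : phi w != 0 by rewrite gt_eqF// gauss_pdf_gt0.
case: (leP b y) => /= [yb _|by_ ya].
  have dL (w : R) : a <= w <= b -> is_derive w 1
      (fun u => Phi u * (1 - Phi y) / phi u)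
      (phi w * (1 - Phi y) / phi w + w * (Phi w * (1 - Phi y) / phi w)).
    move=> _; apply: (is_derive_ratio (p := fun u => Phi u * (1 - Phi y))).
    have := is_deriveM (is_derive_gauss_cdfr w) (is_derive_cst (1 - Phi y) w 1).
    by move/is_derive_eq; apply; rewrite /GRing.scale/=; ring.
  have [c /andP[ac cb] E] := is_derive_MVT ab dL.
  exists c; first by rewrite ac.
  have ay : a <= y := le_trans (ltW ab) yb.
  have cy : c <= y := le_trans (ltW cb) yb.
  rewrite !stein_sol_left//.
  by rewrite E mulrAC divff// mul1r; ring.
have dR (w : R) : a <= w <= b -> is_derive w 1
    (fun u => Phi y * (1 - Phi u) / phi u)
    (- (phi w * Phi y) / phi w + w * (Phi y * (1 - Phi w) / phi w)).
  move=> _; apply: (is_derive_ratio (p := fun u => Phi y * (1 - Phi u))).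
  have := is_deriveM (is_derive_cst (Phi y) w 1)
    (is_deriveB (is_derive_cst (1 : R) w 1) (is_derive_gauss_cdfr w)).
  by move/is_derive_eq; apply; rewrite /GRing.scale/=; ring.
have [c /andP[ac cb] E] := is_derive_MVT ab dR.
exists c; first by rewrite ac.
have yc : y <= c := le_trans ya (ltW ac).
rewrite !stein_sol_right// ?(ltW by_)//.
by rewrite E mulNr mulrAC divff// mul1r addr0; ring.
Qed.

Lemma stein_sol_ge0 w : 0 <= stein_sol w.
Proof.
have := gauss_cdfr_ge0 w; have := gauss_cdfr_ge0 y.
have := gauss_cdfr_le1 w; have := gauss_cdfr_le1 y => ? ? ? ?.
by rewrite /stein_sol; case: ifP => _;
  rewrite divr_ge0 ?mulr_ge0 ?subr_ge0// ltW// gauss_pdf_gt0.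
Qed.

(** Moving [y] to [w] only increases the numerator, which gives a bound uniform in [y]. *)
Let stein_sol_le w : stein_sol w * phi w <= Phi w * (1 - Phi w).
Proof.
have phi0 : phi w != 0 by rewrite gt_eqF// gauss_pdf_gt0.
have [wy|/ltW wy] := leP w y.
  rewrite stein_sol_left// divfK// ler_wpM2l ?gauss_cdfr_ge0//.
  by rewrite lerB// gauss_cdfr_le.
by rewrite stein_sol_right// divfK// ler_wpM2r ?subr_ge0 ?gauss_cdfr_le1// gauss_cdfr_le.
Qed.

(** The Mills bound handles the tail on the side of [w]; the other tail factor is at most 1. *)
Lemma normr_mul_stein_sol w : `|w * stein_sol w| <= 1.
Proof.
rewrite normrM (ger0_norm (stein_sol_ge0 w)) -(ler_pM2r (gauss_pdf_gt0 w)) mul1r.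
have P0 := gauss_cdfr_ge0 w; have P1 := gauss_cdfr_le1 w.
have sl := stein_sol_le w.
rewrite -mulrA; apply: (le_trans (ler_wpM2l (normr_ge0 w) sl)).
have [w0|w0|->] := ltrgt0P w; last by rewrite mul0r ltW// gauss_pdf_gt0.
- apply: le_trans (mills_right w0); rewrite mulrCA ler_piMl//.
  by rewrite mulr_ge0 ?subr_ge0// ltW.
- apply: le_trans (mills_left w0); rewrite mulrA ler_piMr//; last by lra.
  by rewrite mulr_ge0// oppr_ge0 ltW.
Qed.

Lemma stein_sol_le2 w : stein_sol w <= 2.
Proof.
have [w1|/ltW w1] := leP `|w| 1.
  have := gauss_pdf_ge w1 => p8; have := stein_sol_ge0 w => s0.
  (* The constant 2 is the quotient of [Phi w (1 - Phi w) <= 1 / 4] by the lower bound [1 / 8] of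
     the density on [[-1, 1]]. *)
  have : stein_sol w * 8^-1 <= 4^-1.
    apply: le_trans (ler_wpM2l s0 p8) _; apply: (le_trans (stein_sol_le w)).
    by have : 0 <= (Phi w - 2^-1) ^+ 2 := sqr_ge0 _; nra.
  lra.
have := normr_mul_stein_sol w.
rewrite normrM (ger0_norm (stein_sol_ge0 w)) => ws.
apply: (@le_trans _ _ (`|w| * stein_sol w)); last by lra.
by rewrite ler_peMl// stein_sol_ge0.
Qed.

(** By Stein's equation the slope is at most [1 + 1] away from the kink; an interval straddling [y]
    is cut there. *)
Lemma stein_sol_lipschitz a b : `|stein_sol b - stein_sol a| <= 2 * `|b - a|.
Proof.
wlog ab : a b / a <= b => [H|].
  by have [/H//|/ltW/H] := leP a b; rewrite distrC [`|a - b|]distrC.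
have incr c d : c <= d -> (d <= y) || (y <= c) ->
    `|stein_sol d - stein_sol c| <= 2 * (d - c).
  rewrite le_eqVlt => /predU1P[->|cd]; first by rewrite !subrr normr0 mulr0.
  move=> /(stein_sol_increment cd)[xi _ ->].
  have dc : 0 <= d - c by rewrite subr_ge0 ltW.
  rewrite normrM (ger0_norm dc) ler_wpM2r//.
  have := normr_mul_stein_sol xi; have := gauss_cdfr_ge0 y;
    have := gauss_cdfr_le1 y.
  by case: (d <= y) => /=; rewrite !ler_norml; lra.
rewrite [`|b - a|]ger0_norm ?subr_ge0//.
have [yb|/ltW yb] := leP b y; first by rewrite incr// yb.
have [ay|/ltW ay] := leP a y; last by rewrite incr// ay orbT.
have := incr _ _ ay; have := incr _ _ yb;
  rewrite lexx orbT/= => /(_ isT) h1 /(_ isT) h2.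
rewrite (_ : stein_sol b - _ =
  (stein_sol b - stein_sol y) + (stein_sol y - stein_sol a)); last by ring.
by apply: (le_trans (ler_normD _ _)); lra.
Qed.

(** Only [|w|] enters the factor, not [|u|]: with [w] the standardised sum, its second moment
    controls the expectation. *)
Lemma mul_stein_sol_dist u w :
  `|u * stein_sol u - w * stein_sol w| <= (2 * `|w| + 2) * `|u - w|.
Proof.
rewrite (_ : _ - _ =
  w * (stein_sol u - stein_sol w) + (u - w) * stein_sol u); last by ring.
apply: (le_trans (ler_normD _ _)); rewrite !normrM mulrDl lerD//.
  by rewrite -mulrA mulrCA ler_wpM2l// stein_sol_lipschitz.
by rewrite mulrC ler_wpM2r// ger0_norm ?stein_sol_ge0// stein_sol_le2.
Qed.

End stein_solution.

(** * The Berry-Esseen bound *)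

Section berry_esseen.
Variables (R : realType) (P : {poly R}).
Hypothesis zbP : zero_biased P.

Definition coef_mean := coef_law P (fun n => n%:R).
Definition coef_var := coef_law P (fun n => (n%:R - coef_mean) ^+ 2).

Hypothesis var_gt0 : 0 < coef_var.

Local Notation E := (coef_law P).
Local Notation m := coef_mean.
Local Notation s := (Num.sqrt coef_var).

Let P1_neq0 : P.[1] != 0. Proof. by case: zbP => _ P1 _; rewrite gt_eqF. Qed.

(** The bias identity is tested on [f = 1] for the mean and on [f n = n] for the variance. *)
Lemma zero_bias_moments mu v L :
  zero_bias_coupling P mu v L -> mu = coef_mean /\ v = coef_var.
Proof.
move=> [_ marg bias].
have E0 : E (fun n => n%:R - mu) = 0.
  transitivity (E (fun n => (n%:R - mu) * (fun=> 1) n)).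
    by congr coef_law; apply/funext => n; rewrite mulr1.
  transitivity (L (fun _ _ => 0));
    last by rewrite (marg (fun=> 0)) coef_law_cst// mulr0.
  by rewrite -bias; congr L; apply/funext => n; apply/funext => b; exact: subrr.
have Em : mu = m.
  apply/esym/eqP; rewrite -subr_eq0 -E0.
  by rewrite (coef_lawD P (fun n => n%:R) (fun=> - mu)) coef_law_cst.
split=> //; rewrite /coef_var -Em.
have -> : (fun n : nat => (n%:R - mu) ^+ 2) =
    (fun n => (n%:R - mu) * n%:R + (- mu) * (n%:R - mu)).
  by apply/funext => n; ring.
rewrite coef_lawD coef_lawZ E0 mulr0 addr0 -(bias (fun n => n%:R)).
transitivity (L (fun _ _ => 1)).
  by rewrite (marg (fun=> 1)) coef_law_cst// mulr1.
by congr L; apply/funext => n; apply/funext => b; rewrite -natrB// subSnn.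
Qed.

Let z (t : R) : R := (t - m) / s.

Let s_gt0 : 0 < s. Proof. by rewrite sqrtr_gt0. Qed.
Let s_neq0 : s != 0. Proof. by rewrite gt_eqF. Qed.
Let sqr_s : s ^+ 2 = coef_var. Proof. by rewrite sqr_sqrtr// ltW. Qed.

(** The pointwise core: the scaled increment is the slope of the Stein solution over one lattice
    cell, hence given by Stein's equation at some [xi] in that cell; the error comes from moving
    [xi] to [z n]. *)
Let stein_step (k : int) (n b : nat) : (n <= b + 2)%N -> (b <= n + 1)%N ->
  `|(s * stein_sol (z k%:~R) (z b.+1%:R) - s * stein_sol (z k%:~R) (z b%:R)) -
    (((b.+1%:Z <= k)%R%:R - gauss_cdfr (z k%:~R)) +
     z n%:R * stein_sol (z k%:~R) (z n%:R))|
  <= (3 + z n%:R ^+ 2) * (2 / s).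
Proof.
move=> nb bn; set f := stein_sol _.
have zlt t u : (z t < z u) = (t < u) by rewrite /z ltr_pM2r ?invr_gt0// ltrD2r.
have zle t u : (z t <= z u) = (t <= u) by rewrite /z ler_pM2r ?invr_gt0// lerD2r.
have bb : z b%:R < z b.+1%:R by rewrite zlt ltr_nat.
(* As [k] is an integer, [z k] is a lattice point and never interior to the cell. *)
have kb : (z b.+1%:R <= z k%:~R) || (z k%:~R <= z b%:R).
  rewrite !zle -[b.+1%:R]/(b.+1%:Z%:~R) -[b%:R]/(b%:Z%:~R) !ler_int; lia.
have [xi /andP[bxi xib] E1] := stein_sol_increment bb kb.
have zS : z b.+1%:R - z b%:R = s^-1 by rewrite /z -natr1; field.
rewrite zS in E1.
rewrite -mulrBr E1 zle -[b.+1%:R]/(b.+1%:Z%:~R) ler_int.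
rewrite mulrCA divff// mulr1.
rewrite [X in `|X|](_ : _ = xi * f xi - z n%:R * f (z n%:R));
  last by rewrite /f; ring.
apply: (le_trans (mul_stein_sol_dist _ _ _)).
(* The window places the cell between [z (n - 2)] and [z (n + 2)], and one lattice unit is
   [1 / s]. *)
have dn : `|xi - z n%:R| <= 2 / s.
  have z2 t : z t + 2 / s = z (t + 2) by rewrite /z; field.
  rewrite ler_distl lerBlDr z2; apply/andP; split.
    apply: (@le_trans _ _ (z (b%:R + 2))); first by rewrite zle -natrD ler_nat.
    by rewrite -z2 lerD2r ltW.
  rewrite (le_trans (ltW xib))// zle -natrD ler_nat; lia.
apply: ler_pM => //.
(* This yields [2 |w| + 2 <= 3 + w^2] at [w = z n], trading the absolute value for a moment known
   exactly. *)
have : 0 <= (`|z n%:R| - 1) ^+ 2 := sqr_ge0 _.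
by rewrite -[z n%:R ^+ 2]real_normK ?num_real//; lra.
Qed.

(** The standardised sum has second moment 1, so the value is [4 * (2 / s)]. *)
Let EZ2 : E (fun n => (3 + z n%:R ^+ 2) * (2 / s)) = 8 / s.
Proof.
under eq_fun do rewrite mulrC.
rewrite coef_lawZ (coef_lawD P (fun=> 3)) coef_law_cst//.
rewrite (_ : (fun n => z n%:R ^+ 2) =
    (fun n => coef_var^-1 * (n%:R - m) ^+ 2)); last first.
  by apply/funext => n; rewrite /z expr_div_n sqr_s mulrC.
by rewrite coef_lawZ mulVf ?gt_eqF//; field.
Qed.

(** Scaling [f] by [s] makes the right side a multiple of [coef_var], the total mass of [L], so that
    the variance cancels later. *)
Let E_stein (L : (nat -> nat -> R) -> R) (f : R -> R) :
  zero_bias_coupling P m coef_var L ->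
  L (fun _ b => s * f (z b.+1%:R) - s * f (z b%:R)) =
  coef_var * E (fun n => z n%:R * f (z n%:R)).
Proof.
move=> [_ _ bias]; rewrite (bias (fun n => s * f (z n%:R))) -coef_lawZ.
congr coef_law; apply/funext => n.
transitivity (s ^+ 2 * (z n%:R * f (z n%:R))); last by rewrite sqr_s.
by move: (f _) => u; rewrite /z; field.
Qed.

(** Integrating [stein_step] against the coupling leaves [E (W f (W))] on both sides, where it
    cancels. Replacing the indicator in [b] by [g n] makes the integrand [H] depend on [n] alone, so
    the marginal identity evaluates it. *)
Lemma coef_law_le_gauss (k : int) (g : nat -> R) :
  (forall n b, (n <= b + 2)%N -> (b <= n + 1)%N ->
    g n <= (b.+1%:Z <= k)%R%:R) ->
  E g <= gauss_cdfr ((k%:~R - m) / s) + 8 / s.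
Proof.
move=> gk; have [_ _ [mu [v [L zb]]]] := zbP.
have [mE vE] := zero_bias_moments zb; rewrite mE vE in zb.
pose f := stein_sol (z k%:~R).
have := E_stein f zb; have [mono marg _] := zb.
pose H n := g n + (- gauss_cdfr (z k%:~R)) + z n%:R * f (z n%:R)
  + (-1) * ((3 + z n%:R ^+ 2) * (2 / s)).
have : L (fun n _ => H n) <= L (fun _ b => s * f (z b.+1%:R) - s * f (z b%:R)).
  apply: mono => n b nb bn; have := stein_step k nb bn; have := gk n b nb bn.
  rewrite -/f /H ler_norml => h1 /andP[h2 _]; lra.
move=> + Es; rewrite marg Es ler_pM2l// /H !coef_lawD coef_lawZ EZ2 coef_law_cst//.
by rewrite /z; lra.
Qed.

Lemma coef_law_ge_gauss (k : int) (g : nat -> R) :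
  (forall n b, (n <= b + 2)%N -> (b <= n + 1)%N ->
    (b.+1%:Z <= k)%R%:R <= g n) ->
  gauss_cdfr ((k%:~R - m) / s) - 8 / s <= E g.
Proof.
move=> gk; have [_ _ [mu [v [L zb]]]] := zbP.
have [mE vE] := zero_bias_moments zb; rewrite mE vE in zb.
pose f := stein_sol (z k%:~R).
have := E_stein f zb; have [mono marg _] := zb.
pose H n := g n + (- gauss_cdfr (z k%:~R)) + z n%:R * f (z n%:R)
  + (3 + z n%:R ^+ 2) * (2 / s).
have : L (fun _ b => s * f (z b.+1%:R) - s * f (z b%:R)) <= L (fun n _ => H n).
  apply: mono => n b nb bn; have := stein_step k nb bn; have := gk n b nb bn.
  rewrite -/f /H ler_norml => h1 /andP[_ h2]; lra.
move=> + Es; rewrite marg Es ler_pM2l// /H !coef_lawD EZ2 coef_law_cst//.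
by rewrite /z; lra.
Qed.

Lemma coef_law_berry_esseen x :
  `|E (fun n => ((n%:R - m) / s <= x)%R%:R) - gauss_cdfr x| <= 12 / s.
Proof.
pose k := Num.floor (s * x + m).
have kle : k%:~R <= s * x + m by exact: floor_le.
have ltk : s * x + m < (k + 1)%:~R by exact: floorD1_gt.
have indE n : ((n%:R - m) / s <= x) = (n%:Z <= k).
  rewrite ler_pdivrMr// lerBlDr mulrC -[n%:R]/(n%:Z%:~R).
  by rewrite -floor_ge_int.
have [kl kr] : (s * x <= (k + 1)%:~R - m) /\ (k%:~R - m <= s * x).
  by split; lra.
(* Here [n <= k] and [b <= n + 1] force [b + 1 <= k + 2]. *)
have up : E (fun n => ((n%:R - m) / s <= x)%R%:R) <=
    gauss_cdfr (((k + 2)%:~R - m) / s) + 8 / s.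
  apply: coef_law_le_gauss => n b nb bn; rewrite indE ler_nat.
  by case: (leP n%:Z k) => // nk; rewrite (_ : b.+1%:Z <= k + 2)//; lia.
(* Here [b + 1 <= k - 1] and [n <= b + 2] force [n <= k]. *)
have lo : gauss_cdfr (((k - 1)%:~R - m) / s) - 8 / s <=
    E (fun n => ((n%:R - m) / s <= x)%R%:R).
  apply: coef_law_ge_gauss => n b nb bn; rewrite indE ler_nat.
  by case: (leP b.+1%:Z (k - 1)) => // nk; rewrite (_ : n%:Z <= k)//; lia.
(* As [k <= s x + m < k + 1], both [z (k + 2)] and [z (k - 1)] lie within [2 / s] of [x]; since the
   density is at most 1, this adds at most [2 / s] to the error [8 / s]. *)
have y1 : x <= ((k + 2)%:~R - m) / s.
  by rewrite ler_pdivlMr// mulrC; move: ltk; rewrite !intrD; lra.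
have y2 : ((k + 2)%:~R - m) / s <= x + 2 / s.
  by rewrite ler_pdivrMr// mulrDl divfK// mulrC intrD; lra.
have y3 : ((k - 1)%:~R - m) / s <= x.
  by rewrite ler_pdivrMr// mulrC intrB; lra.
have y4 : x - 2 / s <= ((k - 1)%:~R - m) / s.
  by rewrite ler_pdivlMr// mulrBl divfK// mulrC intrB; move: ltk;
    rewrite intrD; lra.
have := gauss_cdfr_lipschitz y1; have := gauss_cdfr_lipschitz y3.
have si : 0 < s^-1 by rewrite invr_gt0.
rewrite ler_norml => l1 l2; apply/andP; split; lra.
Qed.

End berry_esseen.

(** Zero variance would make every index of positive mass equal to the mean, but [i] and [j]
    differ. *)
Lemma coef_var_gt0 (R : realType) (P : {poly R}) (i j : nat) :
  (forall k, 0 <= P`_k) -> i != j -> 0 < P`_i -> 0 < P`_j -> 0 < coef_var P.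
Proof.
move=> P0 ij Pi Pj; have size_gt k : 0 < P`_k -> (k < size P)%N.
  by move=> Pk; rewrite ltnNge; apply/negP => /leq_sizeP/(_ k (leqnn k)) E;
    rewrite E ltxx in Pk.
have P1 : 0 < P.[1].
  rewrite -coef_sum1 /coef_sum (bigD1 (Ordinal (size_gt _ Pi)))//= mulr1.
  by rewrite ltr_pwDl// sumr_ge0// => k _; rewrite mulr1.
rewrite /coef_var /coef_law divr_gt0//.
have ge0 (k : 'I_(size P)) : true -> 0 <= P`_k * (k%:R - coef_mean P) ^+ 2.
  by move=> _; rewrite mulr_ge0 ?sqr_ge0.
rewrite lt0r sumr_ge0 ?andbT//; apply/negP => /eqP /(psumr_eq0P ge0) H.
have mE k : 0 < P`_k -> k%:R = coef_mean P.
  move=> Pk; have /eqP := H (Ordinal (size_gt _ Pk)) isT.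
  by rewrite /= mulf_eq0 gt_eqF//= sqrf_eq0 subr_eq0 => /eqP.
by move: ij; rewrite -(eqr_nat R) mE// mE// eqxx.
Qed.

(** * From random variables to coefficient sums *)

Section polynomial_law.
Variables (R : realType) (P : {poly R}) (d : measure_display).
Variables (T : measurableType d) (Pr : probability T R) (X : {RV Pr >-> R}).
Hypotheses (P1 : 0 < P.[1]) (lawX : has_poly_law P X).

Let A (n : nat) : set T := [set w | X w = n%:R].
Let U := \big[setU/set0]_(i <- iota 0 (size P)) A i.

Let mA n : measurable (A n).
Proof. by rewrite -[A n]setTI;
  exact: (measurable_funPT X) (measurable_set1 _). Qed.

Let mU : measurable U.
Proof. by apply: bigsetU_measurable => i _. Qed.

Let integral_U (g : R -> R) : measurable_fun setT (g \o X) ->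
  (\int[Pr]_(w in U) (g (X w))%:E)%E = (coef_law P (fun n => g n%:R))%:E.
Proof.
move=> mg; rewrite integral_bigsetU_EFin ?iota_uniq//; last 2 first.
- apply/trivIsetP => i j _ _ ij; rewrite -subset0 => w [];
    rewrite /A/= => -> /eqP.
  by rewrite eqr_nat (negbTE ij).
- by apply/measurable_EFinP; exact: measurable_funTS mg.
rewrite /coef_law /coef_sum mulr_suml -sumEFin -(subn0 (size P)) big_mkord subn0.
apply: eq_bigr => i _.
rewrite (eq_integral (cst (g i%:R)%:E)); last first.
  by move=> w; rewrite inE => ->.
have PrA : Pr (A i) = (P`_i / P.[1])%:E.
  by apply: lawX; rewrite /deg -ltnS prednK// (leq_ltn_trans _ (ltn_ord i)).
by rewrite integral_cst// [Y in (_ * Y)%E]PrA -EFinM; congr EFin; ring.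
Qed.

(** [has_poly_law] prescribes point masses only; they sum to 1, so [X] almost surely takes no other
    value. *)
Let Pr_U : Pr U = 1%E.
Proof.
rewrite -[LHS]mul1e -integral_cst// -[RHS]/(1%R%:E) (integral_U (g := cst 1))//.
by rewrite coef_law_cst ?gt_eqF.
Qed.

Lemma integral_poly_law (g : R -> R) : measurable_fun setT (g \o X) ->
  (\int[Pr]_w (g (X w))%:E)%E = (coef_law P (fun n => g n%:R))%:E.
Proof.
move=> mg; rewrite -(integral_U mg).
pose F (b : bool) := if b then U else ~` U.
have FT : [set: T] = \big[setU/set0]_(b <- [:: true; false]) F b.
  by rewrite !big_cons big_nil setU0/= setUv.
rewrite {1}FT integral_bigsetU_EFin//.
- rewrite !big_cons big_nil /= [X in (_ + (X + _))%E]null_set_integral ?adde0//.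
  + exact: measurableC.
  + by apply/measurable_EFinP; exact: measurable_funTS mg.
  + by have := probability_setC Pr mU; rewrite Pr_U subee.
- by case=> //=; exact: measurableC.
- apply/trivIsetP => -[] [] _ _ //= _; rewrite ?setICr ?setICl//.
- by apply/measurable_EFinP; exact: measurable_funTS mg.
Qed.

Lemma expectation_poly_law : ('E_Pr[X])%E = (coef_mean P)%:E.
Proof. by rewrite unlock (integral_poly_law (g := id)). Qed.

Lemma variance_poly_law : ('V_Pr[X])%E = (coef_var P)%:E.
Proof.
rewrite /variance unlock expectation_poly_law unlock/=.
rewrite -(integral_poly_law (g := fun t => (t - coef_mean P) ^+ 2)).
  by apply: eq_integral => w _.
by apply: measurable_funX; exact: measurable_funB.
Qed.

Lemma std_cdf_poly_law x : std_cdf X x = (coef_law P (fun n =>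
  ((n%:R - coef_mean P) / Num.sqrt (coef_var P) <= x)%R%:R))%:E.
Proof.
rewrite /std_cdf expectation_poly_law variance_poly_law /=.
pose Y w := (X w - coef_mean P) / Num.sqrt (coef_var P).
pose h (t : R) : R := ((t - coef_mean P) / Num.sqrt (coef_var P) <= x)%R%:R.
have mY : measurable_fun setT Y.
  by apply: measurable_funM => //; exact: measurable_funB.
set B := [set w | _].
have mB : measurable B.
  rewrite (_ : B = setT `&` Y @^-1` `]-oo, x]); first exact: mY.
  by rewrite setTI; apply/seteqP; split=> w; rewrite /B /= in_itv.
have hE : h \o X = \1_B.
  apply/funext => w; rewrite /h indicE/=; congr (nat_of_bool _)%:R.
  by apply/idP/idP; rewrite inE.
rewrite -(integral_poly_law (g := h)) ?hE//.
transitivity (\int[Pr]_w (\1_B w)%:E)%E;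
  first by rewrite integral_indic// setIT.
by apply: eq_integral => w _; rewrite -hE.
Qed.

End polynomial_law.

(** * The bound for one polynomial and the limit along a family *)

Lemma left_half_plane_poly_zero_biased (R : realType) (P : {poly R}) :
  left_half_plane_poly P -> zero_biased P /\ 0 < coef_var P.
Proof.
move=> [deg1 P0 Pn Pz rP]; split; first exact: zero_biased_left_half_plane.
by apply: (@coef_var_gt0 _ _ 0 (deg P)) => //; rewrite neq_ltn deg1.
Qed.

Lemma gauss_dist_le (R : realType) (P : {poly R}) (d : measure_display)
    (T : measurableType d) (Pr : probability T R) (X : {RV Pr >-> R}) :
  left_half_plane_poly P -> has_poly_law P X ->
  (gauss_dist X <= (12 / Num.sqrt (fine 'V_Pr[X]))%:E)%E.
Proof.
move=> lhpP lawX; have [zbP var0] := left_half_plane_poly_zero_biased lhpP.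
have [_ P1 _] := zbP.
apply: ge_ereal_sup => _ [x _ <-].
rewrite (variance_poly_law P1 lawX) (std_cdf_poly_law P1 lawX) gauss_cdf_fin/=.
by rewrite lee_fin coef_law_berry_esseen.
Qed.

Theorem theorem3p1 (R : realType) :
  (forall (P : {poly R}) (d : measure_display) (T : measurableType d)
      (Pr : probability T R) (X : {RV Pr >-> R}),
    left_half_plane_poly P -> has_poly_law P X ->
    (gauss_dist X <= (12 / Num.sqrt (fine 'V_Pr[X]))%:E)%E) /\
  (forall (I : Type) (P : I -> {poly R}) (d : I -> measure_display)
      (T : forall i : I, measurableType (d i))
      (Pr : forall i : I, probability (T i) R)
      (X : forall i : I, {RV (Pr i) >-> R}),
    (forall i : I, left_half_plane_poly (P i)) ->
    (forall i : I, has_poly_law (P i) (X i)) ->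
    (forall n : nat, exists i : I, (n <= deg (P i))%N) ->
    'V_(Pr i)[X i] @[i --> deg_infty P] --> +oo%E ->
    gauss_dist (X i) @[i --> deg_infty P] --> 0%E).
Proof.
split=> [P d T Pr X|]; first exact: gauss_dist_le.
move=> I P d T Pr X lhpP lawX _ Vy.
have FF : Filter (deg_infty P).
  apply: filter_from_filter; first by exists 0%N.
  move=> m n _ _; exists (maxn m n) => // i /=.
  by rewrite geq_max => /andP[].
have VE i : ('V_(Pr i)[X i])%E = (coef_var (P i))%:E.
  have [[_ P1 _] _] := left_half_plane_poly_zero_biased (lhpP i).
  exact: variance_poly_law P1 (lawX i).
apply: (@squeeze_cvge _ _ _ _ (cst 0%E) _
  (fun i => (12 / Num.sqrt (fine 'V_(Pr i)[X i]))%:E)).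
(* The supremum is nonnegative because it dominates its term at [x = 0]. *)
- apply: nearW => i; rewrite (gauss_dist_le (lhpP i) (lawX i)) andbT.
  apply: (le_trans (abse_ge0 (std_cdf (X i) 0 - gauss_cdf 0)%E)).
  by apply: ereal_sup_ubound; exists 0.
- exact: cvg_cst.
apply: cvg_EFin; first exact: nearW.
apply/cvgrPdist_le => e e0.
(* Variance at least [(12 / e)^2] is exactly what brings the bound down to [e]. *)
have /cvgeyPge/(_ ((12 / e) ^+ 2)) := Vy.
apply: filterS => i; rewrite VE lee_fin => Ve; rewrite /= VE /=.
have s0 : 0 < 12 / e by rewrite divr_gt0.
have sle : 12 / e <= Num.sqrt (coef_var (P i)).
  by rewrite -[leLHS](ger0_norm (ltW s0)) -sqrtr_sqr ler_wsqrtr.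
have sp := lt_le_trans s0 sle.
rewrite sub0r normrN ger0_norm; last by rewrite divr_ge0// ltW.
by rewrite ler_pdivrMr// mulrC -ler_pdivrMr.
Qed.
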